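(* For $N\in\mathbb{N}$ let $\mathcal{H}_{2AP}=([N],\mathcal{E}_{2AP})$ be the hypergraph of sums of two arithmetic progressions in $[N]$. Then, as $N\to\infty$, (i) $\operatorname{disc}(\mathcal{H}_{2AP})=\Omega(N^{1/2})$, and (ii) $\operatorname{disc}(\mathcal{H}_{2AP})=O(N^{1/2}\log^{1/2}N)$. That is, there exist absolute constants $c,C>0$ and $N_0\in\mathbb{N}$ such that for all $N\ge N_0$ one has $c\,N^{1/2}\le \operatorname{disc}(\mathcal{H}_{2AP})\le C\,N^{1/2}(\log N)^{1/2}$.
   Context: For $N\in\mathbb{N}$, $[N]=\{1,2,\dots,N\}$. For $a\in\mathbb{Z}$ and $\delta,L\in\mathbb{N}$ (positive integers), let $A_{a,\delta,L}=\{a+j\delta : j\in\mathbb{Z},\ 0\le j\le L-1\}$. For sets $M_1,M_2\subseteq\mathbb{Z}$, $M_1+M_2=\{m_1+m_2 : m_1\in M_1,\ m_2\in M_2\}$. The hypergraph $\mathcal{H}_{2AP}=([N],\mathcal{E}_{2AP})$ has vertex set $[N]$ and hyperedge set $$\mathcal{E}_{2AP}=\{(A_{a_1,\delta_1,L_1}+A_{a_2,\delta_2,L_2})\cap[N] : a_1,a_2\in\mathbb{Z},\ \delta_1,\delta_2,L_1,L_2\in[N]\}.$$ For a finite hypergraph $\mathcal{H}=(V,\mathcal{E})$ (a finite set $V$ and a set $\mathcal{E}$ of subsets of $V$) and a coloring $\chi\colon V\to\{-1,1\}$, put $\chi(E)=\sum_{x\in E}\chi(x)$ for $E\in\mathcal{E}$,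 $\operatorname{disc}(\mathcal{H},\chi)=\max_{E\in\mathcal{E}}|\chi(E)|$, and $\operatorname{disc}(\mathcal{H})=\min_{\chi\colon V\to\{-1,1\}}\operatorname{disc}(\mathcal{H},\chi)$. *)

(* Defs.v *)
From mathcomp Require Import all_boot all_order all_algebra.
From mathcomp Require Import boolp classical_sets.

Set Implicit Arguments.
Unset Strict Implicit.
Unset Printing Implicit Defensive.

Import Order.TTheory GRing.Theory Num.Theory.

Local Open Scope classical_set_scope.
Local Open Scope ring_scope.

Section Discrepancy.
Variable V : finType.

(* The Boolean [chi x] encodes the colour (-1) ^+ chi x, so [false] is the
   colour 1 and [true] is the colour -1. *)
Definition coloring := {ffun V -> bool}.

Definition color_sum (chi : coloring) (E : {set V}) : int :=
  \sum_(x in E) (-1) ^+ chi x.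

Definition disc_coloring (edges : set {set V}) (chi : coloring) : nat :=
  (\max_(E : {set V} | E \in edges) `|color_sum chi E|)%N.

(* [[ffun=> false]] only witnesses that there is at least one colouring. *)
Definition disc (edges : set {set V}) : nat :=
  disc_coloring edges
    [arg min_(chi < [ffun=> false] : coloring) disc_coloring edges chi]%N.

End Discrepancy.

Definition AP (a : int) (d L : nat) : set int :=
  [set a + j * d%:Z | j in [set j : int | 0 <= j <= L%:Z - 1]].

Definition sumset (M1 M2 : set int) : set int :=
  [set m1 + m2 | m1 in M1 & m2 in M2].

(* The ordinal i : 'I_N stands for the integer i + 1, so that 'I_N represents
   {1, ..., N}; [trace N M] is the intersection of M with this set. *)
Definition trace (N : nat) (M : set int) : {set 'I_N} :=
  finset (fun i : 'I_N => i.+1%:Z \in M).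

Definition edges_2AP (N : nat) : set {set 'I_N} :=
  [set E | exists a1 a2 : int, exists d1 d2 L1 L2 : nat,
    [/\ (1 <= d1 <= N)%N, (1 <= d2 <= N)%N,
        (1 <= L1 <= N)%N, (1 <= L2 <= N)%N
      & E = trace N (sumset (AP a1 d1 L1) (AP a2 d2 L2))]].

Definition disc_2AP (N : nat) : nat := disc (@edges_2AP N).

(* Main.v *)
(** Upper bound: up to the empty set there are at most [N ^ 9 / 2] hyperedges, and
    a uniformly random colouring has exponential moments [E exp(l chi(E))] at
    most [exp(2 l^2 N)]; take [l = sqrt (ln N / N)] and a union bound.

    Lower bound: let [M] be a power of two of order [N] and view a colouring as a
    function [f] on [Z/M]. If [S = {i d1 + j d2 : i < L1, j < L2}] is a direct sum
    of two progressions, Parseval gives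
    [sum_t |f^(t)|^2 |S^(t)|^2 = M sum_a (sum_(s in S) f(a + s))^2],
    and every inner sum on the right is the colour sum of a hyperedge. It remains to
    find a weighted family of patterns [S] for which [|S^(t)|^2] is on average of
    order [N] for every frequency [t]. Consider the lattice of all [(x, y)] with
    [y = t x] modulo [M], of covolume [M], with the maximum norm scaled by [sqrt M].
    If its shortest vector has length about [2^-k], then it supplies [d1],
    while about [4^k] independent lattice vectors of length [O(2^k)] supply [d2]; with
    [L1] of order [2^k sqrt N] and [L2] of order [2^-k sqrt N] no cancellation occurs
    and [|S^(t)|] is of order [N]. There are about [N] pairs [(d1, d2)] for each [k],
    so weighting the scale [k] by [4^-k] makes the total weight of order [N], which
    avoids a logarithmic loss over the scales. *)

Require Import Defs.
From mathcomp Require Import all_boot all_order all_algebra.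
From mathcomp Require Import zify ring lra.
From mathcomp Require Import boolp classical_sets reals topology normedtype.
From mathcomp Require Import sequences derive realfun exp trigo complex.

Set Implicit Arguments.
Unset Strict Implicit.
Unset Printing Implicit Defensive.

Import Order.TTheory GRing.Theory Num.Theory.
Import numFieldNormedType.Exports.

(** * Small multiples modulo M *)

(* [t * x] is within [B] of a multiple of [M]. *)
Definition near0 (M t B x : nat) : bool :=
  ((t * x) %% M <= B) || (M <= (t * x) %% M + B).

Definition direct_AP (L1 L2 d1 d2 : nat) : bool :=
  injectiveb (fun p : 'I_L1 * 'I_L2 => p.1 * d1 + p.2 * d2).

Lemma near0_intro (M t B x : nat) (y q : int) : 0 < M ->
  ((t * x)%:Z = y + q * M%:Z)%R -> `|y|%N <= B -> near0 M t B x.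
Proof.
move=> M0 E yB; rewrite /near0.
have E2 := divn_eq (t * x) M; have := ltn_pmod (t * x) M0.
move: (_ %/ _) (_ %% _) E2 => q' r E2 rM.
apply: contraT; rewrite negb_or -!ltnNge => /andP[h1 h2].
have E3 : (y = r%:Z + (q'%:Z - q) * M%:Z)%R by lia.
have [h|[h|h]] : (q'%:Z - q = 0 \/ 1 <= q'%:Z - q \/ q'%:Z - q <= -1)%R by lia.
- by rewrite h in E3; lia.
- by nia.
- by nia.
Qed.

Lemma near0_elim (M t B x : nat) : 0 < M -> near0 M t B x ->
  exists y q : int, ((t * x)%:Z = y + q * M%:Z)%R /\ `|y|%N <= B.
Proof.
move=> M0; rewrite /near0.
have E2 := divn_eq (t * x) M; have := ltn_pmod (t * x) M0.
move: (_ %/ _) (_ %% _) E2 => q' r E2 rM /orP[h|h].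
- by exists (Posz r), (Posz q'); split; lia.
- by exists (r%:Z - M%:Z)%R, (q'%:Z + 1)%R; split; lia.
Qed.

(** Pigeonhole: the residues of [t * x] fall into [A] cells of width [W], so some cell receives more
    than [c] arguments. Subtracting the least of them from the others gives [c] positive values. *)
Lemma card_near0 (t A W X c : nat) : 0 < A -> 0 < W -> A * c <= X ->
  c <= #|[set x : 'I_X.+1 | (0 < x) && near0 (A * W) t W x]|.
Proof.
move=> A0 W0 AcX; have M0 : 0 < A * W by rewrite muln_gt0 A0.
have cellP (x : 'I_X.+1) : (t * x) %% (A * W) %/ W < A by rewrite ltn_divLR // ltn_pmod.
pose cell x := Ordinal (cellP x).
have [a ca] : exists a : 'I_A, c < #|[set x | cell x == a]|.
  apply/existsP; apply: contraT; rewrite negb_exists => /forallP H.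
  have : \sum_(a < A) #|[set x | cell x == a]| <= \sum_(a < A) c.
    by apply: leq_sum => a _; rewrite leqNgt H.
  rewrite sum_nat_const card_ord.
  have -> : \sum_(a < A) #|[set x | cell x == a]| = X.+1.
    rewrite -[RHS]card_ord -sum1_card (partition_big cell predT) //=.
    by apply: eq_bigr => a _; rewrite -sum1_card; apply: eq_bigl => x; rewrite inE.
  by move=> h; have := leq_trans h AcX; rewrite ltnn.
set F := [set _ | _] in ca.
have /card_gt0P[y0 y0F] : 0 < #|F| by apply: leq_ltn_trans ca.
case: (arg_minnP (fun x : 'I_X.+1 => x : nat) y0F) => x0 x0F' x0min.
have x0F : x0 \in F by [].
have cF : c <= #|F :\ x0|.
  by have := cardsD1 x0 F; rewrite x0F; lia.
apply: leq_trans cF _.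
pose g (x : 'I_X.+1) : 'I_X.+1 := inord (x - x0).
have gE x : g x = x - x0 :> nat.
  by rewrite inordK //; have := ltn_ord x; lia.
have ginj : {in F :\ x0 &, injective g}.
  move=> x y; rewrite !in_setD1 => /andP[_ xF] /andP[_ yF] /(congr1 (@nat_of_ord _)).
  rewrite !gE => h; apply: val_inj => /=; have := x0min _ xF; have := x0min _ yF; lia.
rewrite -(card_in_imset ginj); apply/subset_leq_card/fintype.subsetP => y /imsetP[x].
rewrite in_setD1 => /andP[xx0 xF] ->; rewrite inE gE.
have lex := x0min _ xF.
have ltx : x0 < x by rewrite ltn_neqAle lex andbT eq_sym.
rewrite subn_gt0 ltx /=.
have : (t * x) %% (A * W) %/ W = (t * x0) %% (A * W) %/ W.
  move: xF x0F; rewrite !inE => /eqP xF /eqP x0F.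
  by move: xF; rewrite -x0F => /(congr1 (@nat_of_ord _)).
have E1 := divn_eq (t * x) (A * W); have E2 := divn_eq (t * x0) (A * W).
have F1 := divn_eq ((t * x) %% (A * W)) W; have F2 := divn_eq ((t * x0) %% (A * W)) W.
have l1 := ltn_pmod ((t * x) %% (A * W)) W0; have l2 := ltn_pmod ((t * x0) %% (A * W)) W0.
move=> e; rewrite e in F1.
apply: (@near0_intro _ _ _ _ (((t * x) %% (A * W))%:Z - ((t * x0) %% (A * W))%:Z)%R
  (((t * x) %/ (A * W))%:Z - ((t * x0) %/ (A * W))%:Z)%R) => //.
- by rewrite mulnBr; nia.
- by lia.
Qed.

(* A coincidence [i d1 = j x] lifts to the lattice vectors [(d1, y1)] and [(x, y2)],
   because [i y1 - j y2] is a multiple of [M] smaller than [M]; they are then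
   parallel, and minimality of [d1] makes the second a multiple of the first. *)
Lemma direct_or_multiple (M t L1 L2 D Y Y1 Y2 c d1 x : nat) :
  L1 * Y1 + L2 * Y2 < M -> 0 < d1 -> near0 M t Y1 d1 ->
  (forall r, 0 < r < d1 -> ~~ near0 M t Y1 r) ->
  ~~ ((d1 <= D) && near0 M t Y d1) ->
  x <= c * D -> near0 M t Y2 x -> Y2 <= c * Y ->
  direct_AP L1 L2 d1 x \/ exists2 q, x = q * d1 & q <= c.
Proof.
move=> LM d0 nd1 mind1 notsmall xX nx Y2Y.
have M0 : 0 < M by exact: leq_ltn_trans LM.
have [y1 [q1 [E1 B1]]] := near0_elim M0 nd1.
have [y2 [q2 [E2 B2]]] := near0_elim M0 nx.
case: (boolP (direct_AP L1 L2 d1 x)) => [|nd]; [by left|right].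
have [I [J [J0 IJ lI lJ]]] : exists I J : int, [/\ (J != 0)%R,
   (I * d1%:Z = J * x%:Z)%R, `|I|%N <= L1 & `|J|%N <= L2].
  move: nd; rewrite /direct_AP => /injectivePn[[i j] [[i' j'] ne /= E]].
  exists (i%:Z - i'%:Z)%R, (j'%:Z - j%:Z)%R; split.
  - apply/eqP => h; have jj : j = j' by apply: val_inj => /=; lia.
    case/eqP: ne; rewrite jj; congr (_, _); apply: val_inj => /=.
    by move: E; rewrite jj => /addIn/eqP; rewrite eqn_pmul2r // => /eqP.
  - by clear -E; lia.
  - by clear; have := ltn_ord i; have := ltn_ord i'; lia.
  - by clear; have := ltn_ord j; have := ltn_ord j'; lia.
have par : (I * y1 = J * y2)%R.
  have E3 : (I * y1 - J * y2 = (J * q2 - I * q1) * M%:Z)%R.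
    have : (I * (t * d1)%:Z = J * (t * x)%:Z)%R.
      by rewrite !PoszM mulrCA IJ mulrCA.
    by rewrite E1 E2; clear; lia.
  have B3 : `|(I * y1 - J * y2)%R|%N < M.
    apply: leq_ltn_trans LM; apply: (@leq_trans (`|(I * y1)%R| + `|(J * y2)%R|)).
      by clear; lia.
    by rewrite !abszM leq_add // leq_mul.
  apply/eqP; rewrite -subr_eq0 E3; move: B3; rewrite E3 abszM absz_nat.
  case: (_ - _)%R => [[|m]|m]; rewrite ?mul0r //= => h.
  - by have := leq_ltn_trans (leq_pmull _ (ltn0Sn m)) h; rewrite ltnn.
  - by have := leq_ltn_trans (leq_pmull _ (ltn0Sn m)) h; rewrite ltnn.
have par2 : (x%:Z * y1 = d1%:Z * y2)%R.
  by apply: (mulfI J0); rewrite mulrA -IJ [RHS]mulrCA -par [RHS]mulrCA mulrA.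
(* Subtracting [q] times [(d1, y1)] leaves a parallel lattice vector with first coordinate [r < d1],
   so minimality forces [r = 0]. *)
have Ex := divn_eq x d1; have rd := ltn_pmod x d0.
move: (x %/ d1) (x %% d1) Ex rd => q r Ex rd.
have par3 : (d1%:Z * (y2 - q%:Z * y1) = r%:Z * y1)%R.
  by move: par2; rewrite {1}Ex; clear; lia.
have B4 : `|(y2 - q%:Z * y1)%R|%N <= Y1.
  apply: leq_trans B1; rewrite -(leq_pmul2l d0).
  have := congr1 absz par3; rewrite !abszM !absz_nat => ->.
  by rewrite leq_mul2r (ltnW rd) orbT.
have r0 : r = 0.
  apply/eqP; apply: contraT; rewrite -lt0n => r0.
  have /negP[] := mind1 r (introT andP (conj r0 rd)).
  apply: (@near0_intro _ _ _ _ (y2 - q%:Z * y1)%R (q2 - q%:Z * q1)%R) => //.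
  have : ((t * x)%:Z = q%:Z * (t * d1)%:Z + (t * r)%:Z)%R by rewrite Ex; clear; lia.
  by rewrite E1 E2; clear; lia.
have xq : x = q * d1 by rewrite Ex r0 addn0.
exists q => //.
have yq : (y2 = q%:Z * y1)%R.
  move: par3; rewrite r0 mul0r => /eqP; rewrite mulf_eq0 subr_eq0 => /orP[|/eqP //].
  by rewrite eqz_nat => /eqP h; rewrite h in d0.
(* One coordinate of [(d1, y1)] exceeds [D] or [Y]; for [q > c] the same coordinate of [(x, y2)]
   would exceed [c * D] or [c * Y]. *)
rewrite leqNgt; apply/negP => cq.
move: notsmall; rewrite negb_and -ltnNge => /orP[h|h].
  by move: xX; rewrite xq leqNgt (ltn_mul cq h).
have h2 : Y < `|y1|%N.
  by rewrite ltnNge; apply: contraNN h => h; apply: near0_intro E1 h.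
have := leq_trans B2 Y2Y; rewrite yq abszM absz_nat.
by rewrite leqNgt (ltn_mul cq h2).
Qed.

(** Pigeonhole supplies [4 * c] candidates. Only the [c + 1] multiples [q * d1] with [q <= c] can
    fail, and [3 * c - 1 >= c]. *)
Lemma card_direct (t A W L1 L2 X D Y Y1 c d1 : nat) :
  0 < A -> 0 < W -> 0 < c -> L1 * Y1 + L2 * W < A * W -> 0 < d1 ->
  near0 (A * W) t Y1 d1 -> (forall r, 0 < r < d1 -> ~~ near0 (A * W) t Y1 r) ->
  ~~ ((d1 <= D) && near0 (A * W) t Y d1) ->
  X <= c * D -> W <= c * Y -> A * (4 * c) <= X ->
  c <= #|[set x : 'I_X.+1 | [&& 0 < x, near0 (A * W) t W x & direct_AP L1 L2 d1 x]]|.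
Proof.
move=> A0 W0 c0 LM d0 nd1 mind1 ns XD WY AX; have := card_near0 t A0 W0 AX.
set S := [set _ | _]; set G := [set _ | _] => cS.
pose Q := [set (inord (q * d1) : 'I_X.+1) | q : 'I_c.+1].
have cQ : #|Q| <= c.+1 by rewrite -[X in _ <= X]card_ord; apply: leq_imset_card.
have sub : S \subset G :|: Q.
  apply/fintype.subsetP => x; rewrite !inE => /andP[x0 nx].
  have xX : x <= c * D by apply: leq_trans XD; rewrite -ltnS.
  case: (direct_or_multiple LM d0 nd1 mind1 ns xX nx WY) => [->|[q xq qc]].
  - by rewrite x0 nx.
  - apply/orP; right; apply/imsetP; exists (Ordinal (qc : q < c.+1)) => //=.
    by rewrite -xq inord_val.
have /= h1 := subset_leq_card sub; have [h2 _] := leq_card_setU G Q.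
by move: #|S| #|G| #|Q| #|_ :|: _| cS cQ h1 h2; clear -c0 => *; lia.
Qed.

(** The scale [k] is the largest one whose box, with sides [2 ^ (n - k + 6)] and [2 ^ (n - k + 9)],
    contains a lattice vector; [d1] is the least first coordinate. By maximality this vector misses
    the box of scale [k + 1], which has half the sides. *)
Lemma exists_scale (n t : nat) (M := 2 ^ (2 * n + 15)) : exists k d1 : nat,
  [/\ k <= n, 0 < d1 <= 2 ^ (n - k + 6), near0 M t (2 ^ (n - k + 9)) d1
    & 4 ^ k <= #|[set x : 'I_(2 ^ (n + k + 9)).+1 |
        [&& 0 < x, near0 M t (2 ^ (n + k + 12)) x
          & direct_AP (2 ^ (n + k + 3)) (2 ^ (n - k)) d1 x]]|].
Proof.
have ME k : k <= n -> M = 2 ^ (n - k + 3) * 2 ^ (n + k + 12).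
  by clear; move=> kn; rewrite -expnD; congr (2 ^ _); lia.
have p0 k : 0 < 2 ^ k by rewrite expn_gt0.
pose Q k := (k <= n) && [exists d : 'I_(2 ^ (n - k + 6)).+1,
  (0 < d) && near0 M t (2 ^ (n - k + 9)) d].
(* Scale 0 is Dirichlet's approximation theorem. *)
have Q0 : Q 0.
  rewrite /Q leq0n /= subn0.
  have := @card_near0 t (2 ^ (n + 6)) (2 ^ (n + 9)) (2 ^ (n + 6)) 1 (p0 _) (p0 _).
  rewrite muln1 leqnn => /(_ isT) /card_gt0P[d].
  rewrite inE => dP; apply/existsP; exists d; move: dP; congr (_ && near0 _ _ _ _).
  by rewrite -expnD; congr (2 ^ _); clear; lia.
have Qn k : Q k -> k <= n by case/andP.
case: (ex_maxnP (ex_intro _ 0 Q0) Qn) => k /andP[kn /existsP[d /andP[d0 nd]]] kmax {Q0 Qn}.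
have exd : exists d : nat, (0 < d) && near0 M t (2 ^ (n - k + 9)) d by exists d; rewrite d0.
case: (ex_minnP exd) => d1 /andP[d10 nd1] d1min.
have d1le : d1 <= 2 ^ (n - k + 6).
  by apply: leq_trans (d1min d _) _; [rewrite d0|rewrite -ltnS].
exists k, d1; split=> //; first by rewrite d10.
have mind1 r : 0 < r < d1 -> ~~ near0 M t (2 ^ (n - k + 9)) r.
  case/andP=> r0 rd; apply/negP => nr; have := d1min r; rewrite r0 nr => /(_ isT).
  by rewrite leqNgt rd.
have AX : 2 ^ (n - k + 3) * (4 * 2 ^ (2 * k + 4)) = 2 ^ (n + k + 9).
  by rewrite -[4]/(2 ^ 2) -!expnD; congr (2 ^ _); clear -kn; lia.
have ck : 4 ^ k <= 2 ^ (2 * k + 4) by rewrite -[4]/(2 ^ 2) -expnM leq_exp2l // leq_addr.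
apply: leq_trans ck _; rewrite (ME k kn) in nd1 mind1 *.
have [kn'|kn'] := eqVneq k n.
  (* At the last scale the second progression is a single point. *)
  have := @card_near0 t _ _ _ _ (p0 _) (p0 (n + k + 12)) (eq_leq AX).
  move=> /(leq_trans (leq_pmull _ (isT : 0 < 4))) h; apply: leq_trans h _.
  apply/subset_leq_card/fintype.subsetP => x; rewrite !inE => /andP[-> ->] /=.
  apply/injectiveP => -[i j] [i' j'] /=.
  have j0 (j1 : 'I_(2 ^ (n - k))) : j1 = 0 :> nat.
    have e1 : 2 ^ (n - k) = 1 by rewrite kn' subnn.
    by apply/eqP; rewrite -leqn0 -ltnS -[X in _ < X]e1.
  rewrite !j0 => /addIn/eqP; rewrite eqn_pmul2r // => /eqP ii.
  by congr (_, _); apply: val_inj => //=; rewrite !j0.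
have kn1 : k < n by rewrite ltn_neqAle kn' kn.
(* [D] and [Y] are the sides of the box of scale [k + 1]; with [c = 2 ^ (2 * k + 4)] both
   [X = c * D] and [W = c * Y] hold exactly. *)
apply: (@card_direct _ _ _ _ _ _ (2 ^ (n - k + 5)) (2 ^ (n - k + 8)) (2 ^ (n - k + 9))) => //.
- rewrite -!expnD (_ : n + k + 3 + _ = 2 * n + 12); last by clear -kn; lia.
  rewrite (_ : n - k + (n + k + 12) = 2 * n + 12); last by clear -kn; lia.
  rewrite (_ : n - k + 3 + _ = 2 * n + 12 + 2 + 1); last by clear -kn; lia.
  by rewrite addnn -mul2n mulnC -expnSr ltn_exp2l // -addnA -[X in X < _]addn1 ltn_add2l.
- apply/negP => /andP[ds ns]; have : Q k.+1.
    have kE e : n - k.+1 + e.+1 = n - k + e by clear -kn1; lia.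
    rewrite /Q kn1 /= !kE; apply/existsP; exists (Ordinal (ds : d1 < (2 ^ (n - k + 5)).+1)).
    by rewrite d10 /= (ME k kn).
  by move=> /kmax; rewrite ltnn.
- by rewrite -expnD leq_exp2l //; clear -kn; lia.
- by rewrite -expnD leq_exp2l //; clear -kn; lia.
- by rewrite AX.
Qed.

Local Open Scope ring_scope.

(** * Fourier analysis of two-dimensional progressions *)

Lemma sum_shift_mod (V : nmodType) (M s : nat) (F : nat -> V) : (0 < M)%N ->
  \sum_(a < M) F ((a + s) %% M)%N = \sum_(a < M) F a.
Proof.
case: M => // M _; rewrite [RHS](reindex_inj (addIr (inZp s : 'I_M.+1))) /=.
by apply: eq_bigr => a _; rewrite modnDmr.
Qed.

Lemma norm_exprB1 (C : numDomainType) (w : C) (i : nat) : `|w| = 1 ->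
  `|w ^+ i - 1| <= i%:R * `|w - 1|.
Proof.
move=> w1; elim: i => [|i IH]; first by rewrite expr0 subrr normr0 mul0r.
have -> : w ^+ i.+1 - 1 = w ^+ i * (w - 1) + (w ^+ i - 1).
  by rewrite mulrBr mulr1 -exprSr addrA subrK.
apply: le_trans (ler_normD _ _) _; rewrite normrM normrX w1 expr1n mul1r.
by rewrite -natr1 mulrDl mul1r addrC lerD2r.
Qed.

Section Fourier.
Variables (C : numClosedFieldType) (M : nat) (z : C).
Hypothesis zM : M.-primitive_root z.

Let M0 : (0 < M)%N := prim_order_gt0 zM.

Let normz : `|z| = 1.
Proof.
apply: (@pexpIrn _ M) => //; rewrite ?nnegrE ?normr_ge0 ?ler01 //.
by rewrite -normrX (prim_expr_order zM) normr1 expr1n.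
Qed.

Let z0 : z != 0.
Proof. by rewrite -normr_eq0 normz oner_eq0. Qed.

Let conjzX k : (z ^+ k)^* = (z ^+ k)^-1.
Proof. by rewrite invC_norm normrX normz !expr1n invr1 mul1r. Qed.

Lemma parseval (h : 'I_M -> C) :
  \sum_(t < M) `|\sum_(x < M) h x * z ^+ (t * x)| ^+ 2
  = M%:R * \sum_(x < M) `|h x| ^+ 2.
Proof.
under eq_bigr => t _.
  rewrite normCK rmorph_sum /= big_distrlr /=.
  under eq_bigr => x _ do under eq_bigr => y _ do
    rewrite rmorphM /= conjzX mulrACA !(mulnC t) !exprM -exprVn -exprMn.
  over.
rewrite exchange_big /= mulr_sumr; apply: eq_bigr => x _.
rewrite exchange_big /= (bigD1 x) //= [X in _ + X]big1 ?addr0 => [|y yx].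
  rewrite divff ?expf_neq0 //.
  under eq_bigr do rewrite expr1n mulr1.
  by rewrite sumr_const card_ord mulr_natl -normCK.
(* Off the diagonal [w] is an [M]-th root of unity other than 1, so its geometric sum vanishes. *)
rewrite -mulr_sumr; set w := _ / _.
have w1 : w != 1.
  rewrite /w -(inj_eq (mulIf (_ : z ^+ y != 0))) ?expf_neq0 //.
  rewrite divfK ?expf_neq0 // mul1r.
  by rewrite (eq_prim_root_expr zM) !modn_small // eq_sym.
have wM : w ^+ M = 1.
  by rewrite /w exprMn exprVn -!exprM !(mulnC _ M) !exprM (prim_expr_order zM) !expr1n divr1.
have : (w - 1) * \sum_(i < M) w ^+ i = 0 by rewrite -subrX1 wM subrr.
by move/eqP; rewrite mulf_eq0 subr_eq0 (negPf w1) => /eqP ->; rewrite mulr0.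
Qed.

(** The transform of [a |-> sum_i f (a + s i)] is that of [f] times the conjugate exponential sum of
    [s]; Parseval applies to it. *)
Lemma parseval_pattern (I : finType) (f : nat -> C) (s : I -> nat) :
  \sum_(t < M) `|\sum_(x < M) f x * z ^+ (t * x)| ^+ 2 * `|\sum_i z ^+ (t * s i)| ^+ 2
  = M%:R * \sum_(a < M) `|\sum_i f ((a + s i) %% M)%N| ^+ 2.
Proof.
rewrite -parseval; apply: eq_bigr => t _; rewrite -exprMn; congr (_ ^+ 2).
rewrite -[X in _ * X]norm_conjC rmorph_sum /= -normrM; congr `|_|.
under [RHS]eq_bigr do rewrite mulr_suml.
rewrite exchange_big mulr_sumr /=; apply: eq_bigr => i _; rewrite conjzX.
apply: (mulIf (_ : z ^+ (t * s i) != 0)); first by rewrite expf_neq0.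
rewrite divfK ?expf_neq0 // mulr_suml.
rewrite -(@sum_shift_mod _ M (s i) (fun x => f x * z ^+ (t * x))) //; apply: eq_bigr => a _.
by rewrite -mulrA -exprD -mulnDr -(prim_expr_mod zM) modnMmr (prim_expr_mod zM).
Qed.

(** The term of index [i] is within [i * |w - 1|] of 1, so the sum deviates from [L] by at most
    [L / 2]. *)
Lemma norm_geometric_sum (w : C) (L : nat) : `|w| = 1 -> `|w - 1| * L%:R <= 1 ->
  L%:R / 2%:R <= `|\sum_(i < L) w ^+ i|.
Proof.
move=> w1 wL.
have h i := norm_exprB1 i w1.
have hs : \sum_(i < L) `|w ^+ i - 1| <= L%:R / 2%:R.
  have [->|L0] := posnP L; first by rewrite big_ord0 mul0r.
  apply: (@le_trans _ _ (\sum_(i < L) (i%:R * `|w - 1|))); first exact: ler_sum.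
  have h2 : (2 * \sum_(i < L) i <= L * L)%N.
    elim: L {wL L0} => [|L IH]; first by rewrite big_ord0.
    by rewrite big_ord_recr /= mulnDr mulSn mulnS; move: (\sum_(i < L) _)%N IH => S; lia.
  rewrite -mulr_suml -natr_sum ler_pdivlMr ?ltr0n // mulrC mulrA -natrM.
  apply: (@le_trans _ _ ((L * L)%:R * `|w - 1|)); first by rewrite ler_wpM2r ?ler_nat.
  by rewrite natrM -mulrA ler_piMr // mulrC.
have E : \sum_(i < L) w ^+ i = L%:R + \sum_(i < L) (w ^+ i - 1).
  by rewrite sumrB sumr_const card_ord addrC subrK.
rewrite E; apply: le_trans (lerB_normD _ _); rewrite normr_nat.
rewrite lerBrDr; apply: le_trans (lerD (lexx _) (le_trans (ler_norm_sum _ _ _) hs)) _.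
by rewrite -splitr.
Qed.

Lemma near0_norm (t B d : nat) : near0 M t B d -> `|z ^+ (t * d) - 1| <= B%:R * `|z - 1|.
Proof.
rewrite /near0 -(prim_expr_mod zM) => /orP[h|h].
  by apply: le_trans (norm_exprB1 _ normz) _; rewrite ler_wpM2r ?ler_nat.
(* A residue just below [M] acts as the small negative number [r - M]. *)
set r := (_ %% _)%N in h *; have rM : (r < M)%N by rewrite ltn_pmod.
have -> : z ^+ r - 1 = - (z ^+ r * (z ^+ (M - r) - 1)).
  by rewrite mulrBr mulr1 -exprD subnKC ?(ltnW rM) // (prim_expr_order zM) opprB.
rewrite normrN normrM normrX normz expr1n mul1r.
apply: le_trans (norm_exprB1 _ normz) _; rewrite ler_wpM2r ?ler_nat //; lia.
Qed.

Lemma near0_norm_sum (t B L d : nat) : B%:R * L%:R * `|z - 1| <= 1 -> near0 M t B d ->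
  L%:R / 2%:R <= `|\sum_(i < L) z ^+ (t * (i * d))|.
Proof.
move=> h /near0_norm nd.
under eq_bigr => i _ do rewrite (mulnC i) mulnA exprM.
apply: norm_geometric_sum; first by rewrite normrX normz expr1n.
by apply: le_trans h; rewrite mulrAC; apply: ler_wpM2r.
Qed.

Lemma near0_norm_pattern (t B1 B2 L1 L2 d1 d2 : nat) :
  B1%:R * L1%:R * `|z - 1| <= 1 -> B2%:R * L2%:R * `|z - 1| <= 1 ->
  near0 M t B1 d1 -> near0 M t B2 d2 ->
  (L1 * L2)%:R / 4%:R <=
    `|\sum_(p : 'I_L1 * 'I_L2) z ^+ (t * (p.1 * d1 + p.2 * d2))|.
Proof.
move=> h1 h2 n1 n2.
have -> : \sum_(p : 'I_L1 * 'I_L2) z ^+ (t * (p.1 * d1 + p.2 * d2))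
   = (\sum_(i < L1) z ^+ (t * (i * d1))) * (\sum_(j < L2) z ^+ (t * (j * d2))).
  rewrite big_distrlr pair_bigA /=; apply: eq_bigr => p _.
  by rewrite mulnDr exprD.
rewrite normrM (_ : 4%:R = 2%:R * 2%:R :> C) -?natrM //.
rewrite [(L1 * L2)%:R]natrM [X in _ / X]natrM invfM mulrACA.
by apply: ler_pM; rewrite ?divr_ge0 ?ler0n //; apply: near0_norm_sum; eassumption.
Qed.

End Fourier.

(** * Averaging over weighted patterns *)

Lemma sum_expn4 n : (\sum_(k < n.+1) 4 ^ (n - k) <= 2 * 4 ^ n)%N.
Proof.
elim: n => [|n IH]; first by rewrite big_ord1.
rewrite big_ord_recl /= subn0; under eq_bigr => k _ do rewrite /bump /= add1n subSS.
by apply: leq_trans (leq_add (leqnn _) IH) _; rewrite expnS; lia.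
Qed.

(** The sum of [F t * G t] is estimated twice: [exists_scale] bounds [G] below at every frequency,
    while Parseval bounds each pair [(d1, d2)] by [M ^ 2 * Delta], with at most [4 * M] pairs per
    scale. Comparing powers of two leaves [2 ^ 31]. *)
Lemma pattern_lower_bound (C : numClosedFieldType) (n : nat) (z : C) (f : nat -> C) (Delta : C)
    (M := (2 ^ (2 * n + 15))%N) :
  M.-primitive_root z -> `|z - 1| <= 8%:R / M%:R -> 0 <= Delta ->
  (forall k d1 d2 a : nat, (k <= n)%N -> (0 < d1 <= 2 ^ (n - k + 6))%N ->
     (0 < d2 <= 2 ^ (n + k + 9))%N ->
     direct_AP (2 ^ (n + k + 3)) (2 ^ (n - k)) d1 d2 -> (a < M)%N ->
     `|\sum_(p : 'I_(2 ^ (n + k + 3)) * 'I_(2 ^ (n - k)))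
          f ((a + (p.1 * d1 + p.2 * d2)) %% M)%N| ^+ 2 <= Delta) ->
  \sum_(x < M) `|f x| ^+ 2 <= 2%:R ^+ 31 * Delta.
Proof.
move=> zM z1 D0 fD; have M0 : (0 < M)%N by rewrite expn_gt0.
have MR0 : 0 < M%:R :> C by rewrite ltr0n.
have E4 k : (k <= n)%N -> (2 ^ (n + k + 3) * 2 ^ (n - k) = 2 ^ (2 * n + 1) * 4)%N.
  by clear; move=> kn; rewrite -[4%N]/(2 ^ 2)%N -!expnD; congr (2 ^ _)%N; lia.
have E15 k : (k <= n)%N -> (2 ^ (n - k + 6) * 2 ^ (n + k + 9) = M)%N.
  by rewrite /M; clear; move=> kn; rewrite -!expnD; congr (2 ^ _)%N; lia.
have E1 k : (k <= n)%N -> (2 ^ (n - k + 9) * 2 ^ (n + k + 3) * 8 = M)%N.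
  by rewrite /M; clear; move=> kn; rewrite -[8%N]/(2 ^ 3)%N -!expnD; congr (2 ^ _)%N; lia.
have E2 k : (k <= n)%N -> (2 ^ (n + k + 12) * 2 ^ (n - k) * 8 = M)%N.
  by rewrite /M; clear; move=> kn; rewrite -[8%N]/(2 ^ 3)%N -!expnD; congr (2 ^ _)%N; lia.
pose T k d1 d2 t : C := `|\sum_(p : 'I_(2 ^ (n + k + 3)) * 'I_(2 ^ (n - k)))
   z ^+ (t * (p.1 * d1 + p.2 * d2))| ^+ 2.
pose D k d1 d2 := [&& (0 < d1)%N, (0 < d2)%N & direct_AP (2 ^ (n + k + 3)) (2 ^ (n - k)) d1 d2].
pose F t : C := `|\sum_(x < M) f x * z ^+ (t * x)| ^+ 2.
(* The weight [4 ^ (n - k)] is [4 ^ -k] made integral; it offsets the [4 ^ k] choices of [d2], yet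
   its sum over [k] is at most [2 * 4 ^ n]. *)
pose G t : C := \sum_(k < n.+1) (4 ^ (n - k))%:R * \sum_(d1 < (2 ^ (n - k + 6)).+1)
   \sum_(d2 < (2 ^ (n + k + 9)).+1 | D k d1 d2) T k d1 d2 t.
have T0 k d1 d2 t : 0 <= T k d1 d2 t by rewrite exprn_ge0.
have G_ge t : (4 ^ n * 2 ^ (4 * n + 2))%:R <= G t.
  have [k [d1 [kn /andP[d10 d1le] nd1 card]]] := exists_scale n t.
  have d1lt : (d1 < (2 ^ (n - k + 6)).+1)%N by [].
  rewrite /G (bigD1 (Ordinal (kn : (k < n.+1)%N))) //= (bigD1 (Ordinal d1lt)) //=.
  rewrite mulrDr -addrA ler_wpDr //.
    rewrite addr_ge0 ?mulr_ge0 ?sumr_ge0 // => i _; rewrite ?mulr_ge0 ?sumr_ge0 // => j _;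
    by rewrite sumr_ge0.
  have -> : (4 ^ n = 4 ^ (n - k) * 4 ^ k)%N by rewrite -expnD subnK.
  rewrite -mulnA natrM ler_pM2l ?ltr0n ?expn_gt0 //.
  apply: (@le_trans _ _ (\sum_(d2 in [set x : 'I_(2 ^ (n + k + 9)).+1 |
        [&& (0 < x)%N, near0 M t (2 ^ (n + k + 12)) x
          & direct_AP (2 ^ (n + k + 3)) (2 ^ (n - k)) d1 x]]) T k d1 d2 t)); last first.
    rewrite [X in _ <= X](bigID (fun d2 : 'I_(2 ^ (n + k + 9)).+1 =>
      near0 M t (2 ^ (n + k + 12)) d2)) /=.
    rewrite ler_wpDr ?sumr_ge0 // le_eqVlt; apply/orP; left; apply/eqP.
    by apply: eq_bigl => x; rewrite inE /D d10 /= -andbA [X in _ = _ && X]andbC.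
  apply: (@le_trans _ _ ((4 ^ k)%:R * (2 ^ (4 * n + 2))%:R)); first by rewrite natrM.
  apply: (@le_trans _ _ (\sum_(d2 in [set x : 'I_(2 ^ (n + k + 9)).+1 |
        [&& (0 < x)%N, near0 M t (2 ^ (n + k + 12)) x
          & direct_AP (2 ^ (n + k + 3)) (2 ^ (n - k)) d1 x]]) (2 ^ (4 * n + 2))%:R)).
    by rewrite sumr_const -[X in _ <= X]mulr_natl ler_wpM2r ?ler_nat.
  apply: ler_sum => d2; rewrite inE => /and3P[d20 nd2 dir].
  have h12 B L : (B * L * 8 = M)%N -> B%:R * L%:R * `|z - 1| <= 1.
    move=> BL; rewrite -natrM; apply: (le_trans (ler_wpM2l (ler0n _ _) z1)).
    by rewrite mulrA -natrM BL divff // gt_eqF.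
  have := near0_norm_pattern zM (h12 _ (2 ^ (n + k + 3))%N _) (h12 _ (2 ^ (n - k))%N _) nd1 nd2.
  move=> /(_ (E1 _ kn) (E2 _ kn)) h.
  rewrite /T; apply: le_trans (_ : _ <= ((2 ^ (2 * n + 1))%:R) ^+ 2) _.
    by rewrite -natrX -expnM (_ : (2 * n + 1) * 2 = 4 * n + 2)%N //; clear; lia.
  rewrite lerXn2r ?nnegrE ?ler0n ?normr_ge0 //; apply: le_trans h.
  by rewrite ler_pdivlMr ?ltr0n // -natrM (E4 _ kn).
have sumF : \sum_(t < M) F t = M%:R * \sum_(x < M) `|f x| ^+ 2.
  exact: (parseval zM (fun x : 'I_M => f x)).
have upper : \sum_(t < M) F t * G t <= (2 * 4 ^ n)%:R * (4%:R * M%:R ^+ 3 * Delta).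
  have -> : \sum_(t < M) F t * G t =
      \sum_(k < n.+1) (4 ^ (n - k))%:R * \sum_(d1 < (2 ^ (n - k + 6)).+1)
   \sum_(d2 < (2 ^ (n + k + 9)).+1 | D k d1 d2) \sum_(t < M) F t * T k d1 d2 t.
    under eq_bigr do rewrite mulr_sumr.
    rewrite exchange_big; apply: eq_bigr => k _ /=.
    under eq_bigr do rewrite mulrCA mulr_sumr.
    rewrite -mulr_sumr; congr (_ * _).
    rewrite exchange_big; apply: eq_bigr => d1 _ /=.
    under eq_bigr do rewrite mulr_sumr.
    by rewrite exchange_big.
  apply: (@le_trans _ _ (\sum_(k < n.+1) (4 ^ (n - k))%:R * (4%:R * M%:R ^+ 3 * Delta))).
    apply: ler_sum => k _; apply: ler_wpM2l => //.
    apply: (@le_trans _ _ (\sum_(d1 < (2 ^ (n - k + 6)).+1)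
        \sum_(d2 < (2 ^ (n + k + 9)).+1) M%:R ^+ 2 * Delta)).
      apply: ler_sum => d1 _; rewrite [X in _ <= X](bigID (fun d2 : 'I__ => D k d1 d2)) /=.
      apply: ler_wpDr; first by rewrite sumr_ge0 // => d2 _; rewrite mulr_ge0 ?exprn_ge0.
      apply: ler_sum => d2 /and3P[d10 d20 dir].
      rewrite (parseval_pattern zM) expr2 -mulrA ler_pM2l //.
      rewrite -[X in X%:R * _](card_ord M) mulr_natl -sumr_const.
      have d1le : (0 < d1 <= 2 ^ (n - k + 6))%N by rewrite d10 /= -ltnS.
      have d2le : (0 < d2 <= 2 ^ (n + k + 9))%N by rewrite d20 /= -ltnS.
      by apply: ler_sum => a _; apply: (fD k d1 d2 a (ltn_ord k)).
    rewrite !sumr_const !card_ord -mulrnA -[X in X <= _]mulr_natl mulrA ler_wpM2r //.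
    rewrite [_ ^+ 3]exprS mulrA ler_wpM2r ?exprn_ge0 // -natrM ler_nat.
    rewrite -(E15 k (ltn_ord k)).
    have := expn_gt0 2 (n - k + 6); have := expn_gt0 2 (n + k + 9).
    by move: (2 ^ _)%N (2 ^ _)%N => u v; clear => /= v0 u0; nia.
  by rewrite -mulr_suml -natr_sum ler_wpM2r ?ler_nat ?sum_expn4 // !mulr_ge0 ?exprn_ge0.
have lower : (4 ^ n * 2 ^ (4 * n + 2))%:R * (M%:R * \sum_(x < M) `|f x| ^+ 2) <=
    \sum_(t < M) F t * G t.
  rewrite -sumF mulr_sumr; apply: ler_sum => t _.
  by rewrite mulrC ler_wpM2l // exprn_ge0.
have := le_trans lower upper.
have -> : (2 * 4 ^ n)%:R * (4%:R * M%:R ^+ 3 * Delta) =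
    (4 ^ n * 2 ^ (4 * n + 2))%:R * (M%:R * (2%:R ^+ 31 * Delta)).
  rewrite !mulrA; congr (_ * _).
  rewrite -[4%N]/(2 ^ 2)%N /M !natrM !natrX -[2%:R]expr1 -!exprM -!exprD.
  by congr (_ ^+ _); clear; lia.
by rewrite !ler_pM2l // ltr0n muln_gt0 !expn_gt0.
Qed.

(** * A primitive root of unity near 1 *)

Local Open Scope complex_scope.

Lemma norm_sin_le (R : realType) (y : R) : 0 <= y -> `|sin y| <= y.
Proof.
move=> y0.
have sinD z : z \in `]0, y[%R -> is_derive z 1 (@sin R) (cos z).
  by move=> _; exact: is_derive_sin.
have [|c _] := MVT_segment y0 sinD.
  by apply: continuous_subspaceT; exact: continuous_sin.
rewrite sin0 !subr0 => ->; rewrite normrM (ger0_norm y0) ler_piMl //.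
by rewrite ler_norml cos_le1 cos_geN1.
Qed.

Lemma cos_ge_quadratic (R : realType) (x : R) : 0 <= x -> 1 - x ^+ 2 / 2 <= cos x.
Proof.
move=> x0; have x2 : 0 <= x / 2 by lra.
have xE : x = (x / 2) *+ 2 by rewrite -mulr_natr; lra.
have : sin (x / 2) ^+ 2 <= (x / 2) ^+ 2.
  by rewrite -real_normK ?num_real // lerXn2r ?nnegrE // norm_sin_le.
by rewrite [in cos x]xE cos_mulr2n cos2sin2 -mulr_natr; lra.
Qed.

Lemma exp_cis (R : realType) (x : R) (n : nat) :
  (cos x +i* sin x) ^+ n = cos (x * n%:R) +i* sin (x * n%:R).
Proof.
elim: n => [|n IH]; first by rewrite mulr0 cos0 sin0.
rewrite exprSr IH -natr1 mulrDr mulr1 cosD sinD.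
by apply/eqP; rewrite eq_complex /=; apply/andP; split; apply/eqP; ring.
Qed.

(** Since [M] is a power of two, an order below [M] would divide [M / 2], but that power of the root
    is -1. The chord is at most the angle [2 * pi / M], and [pi < 4]. *)
Lemma exists_prim_root_near1 (R : realType) (s : nat) (M := (2 ^ s.+1)%N) :
  exists2 z : R[i], M.-primitive_root z & `|z - 1| <= 8%:R / M%:R.
Proof.
have M0 : 0 < M%:R :> R by rewrite ltr0n expn_gt0.
pose x : R := pi *+ 2 / M%:R.
exists (cos x +i* sin x).
  have zM : (cos x +i* sin x) ^+ M = 1.
    by rewrite exp_cis /x divfK ?gt_eqF // cos2pi sin2pi.
  have [d dz dM] := prim_order_exists (expn_gt0 2 s.+1) zM.
  suff -> : M = d by [].
  move: dM; rewrite /M => /(dvdn_pfactor _ _ (isT : prime 2))[k ks dk].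
  move: ks; rewrite leq_eqVlt => /orP[/eqP <- //|]; rewrite ltnS => ks.
  have : (cos x +i* sin x) ^+ (2 ^ s) = 1.
    have /dvdnP[q ->] : (d %| 2 ^ s)%N by rewrite dk dvdn_exp2l.
    by rewrite mulnC exprM (prim_expr_order dz) expr1n.
  rewrite exp_cis (_ : x * _ = pi); last first.
    rewrite /x /M expnS natrM -mulr_natr; field.
    by rewrite pnatr_eq0 -lt0n expn_gt0.
  rewrite cospi sinpi => /eqP; rewrite eq_complex /= => /andP[/eqP h _].
  by exfalso; lra.
have x0 : 0 <= x by rewrite divr_ge0 // mulrn_wge0 // pi_ge0.
have h1 := cos_ge_quadratic x0.
have xle : x <= 8 / M%:R.
  by rewrite ler_pM2r ?invr_gt0 //; have := @pihalf_lt2 R; lra.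
rewrite normc_def /=.
have -> : 8%:R / M%:R = (8 / M%:R : R)%:C by rewrite rmorphM fmorphV !rmorph_nat.
rewrite lecR; apply: (@le_trans _ _ x) => //.
rewrite -[leRHS](ger0_norm x0) -sqrtr_sqr ler_sqrt ?sqr_ge0 //.
by have := cos2Dsin2 x; nra.
Qed.

Local Close Scope complex_scope.

(** * Hyperedges and colour sums *)

Lemma disc_coloring_ge (V : finType) (edges : set {set V}) (chi : coloring V) (E : {set V}) :
  E \in edges -> (`|color_sum chi E| <= disc_coloring edges chi)%N.
Proof. by move=> EE; rewrite /disc_coloring (bigD1 E) //= leq_maxl. Qed.

Lemma disc_le (V : finType) (edges : set {set V}) (chi : coloring V) :
  (disc edges <= disc_coloring edges chi)%N.
Proof. by rewrite /disc; case: arg_minnP => // chi0 _; apply. Qed.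

Lemma sumset_APE (a1 a2 : int) (d1 d2 L1 L2 : nat) (y : int) :
  sumset (AP a1 d1 L1) (AP a2 d2 L2) y <->
  exists p : 'I_L1 * 'I_L2, y = a1 + a2 + (p.1 * d1 + p.2 * d2)%N%:Z.
Proof.
split.
  move=> [_ [j1 /= j1L <-] [_ [j2 /= j2L <-] <-]].
  have l1 : (`|j1| < L1)%N by lia.
  have l2 : (`|j2| < L2)%N by lia.
  by exists (Ordinal l1, Ordinal l2) => /=; lia.
move=> [[i j] /= ->].
exists (a1 + i%:Z * d1%:Z); first by exists i%:Z => //=; have := ltn_ord i; lia.
exists (a2 + j%:Z * d2%:Z); first by exists j%:Z => //=; have := ltn_ord j; lia.
by lia.
Qed.

(** The colouring extended by 0 outside {1, ..., N}; at most one index contributes to the sum. *)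
Definition color_ext (N : nat) (chi : coloring 'I_N) (x : nat) : int :=
  \sum_(i < N | i.+1 == x) (-1) ^+ chi i.

(** Directness counts each vertex once, and the room in [M] prevents a translate from meeting [N]
    both before and after wrapping around. *)
Lemma color_sum_pattern (N M : nat) (chi : coloring 'I_N) (L1 L2 d1 d2 a : nat) :
  (1 <= d1 <= N)%N -> (1 <= d2 <= N)%N -> (1 <= L1 <= N)%N -> (1 <= L2 <= N)%N ->
  direct_AP L1 L2 d1 d2 -> (N + (L1 * d1 + L2 * d2) <= M)%N -> (a < M)%N ->
  exists2 E, E \in @edges_2AP N &
    \sum_(p : 'I_L1 * 'I_L2) color_ext chi ((a + (p.1 * d1 + p.2 * d2)) %% M)%N
    = color_sum chi E.
Proof.
move=> hd1 hd2 hL1 hL2 /injectiveP inj NM aM.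
(* A start above [N] can reach [N] only after wrapping, so it stands for the integer [a - M]. *)
pose a0 : int := if (a <= N)%N then a%:Z else a%:Z - M%:Z.
have key (i : 'I_N) (p : 'I_L1 * 'I_L2) :
    (i.+1 == (a + (p.1 * d1 + p.2 * d2)) %% M)%N
    = (i.+1%:Z == a0 + 0 + (p.1 * d1 + p.2 * d2)%N%:Z).
  have sM : (N + (p.1 * d1 + p.2 * d2) < M)%N.
    have := ltn_ord p.1; have := ltn_ord p.2; nia.
  move: (p.1 * d1 + p.2 * d2)%N sM => s sM; have iN := ltn_ord i; rewrite /a0.
  case: ifP => aN; first by rewrite modn_small; lia.
  case: (ltnP (a + s)%N M) => h; first by rewrite modn_small; lia.
  have -> : (a + s = a + s - M + M)%N by lia.
  by rewrite modnDr modn_small; lia.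
exists (trace N (sumset (AP a0 d1 L1) (AP 0 d2 L2))).
  by rewrite inE; exists a0, 0, d1, d2, L1, L2.
rewrite /color_ext (exchange_big_dep predT) //= /color_sum.
rewrite [RHS]big_mkcond /=; apply: eq_bigr => i _.
rewrite inE; case: ifPn => [|ni].
  rewrite inE => /sumset_APE[p0 ip0]; rewrite (big_pred1 p0) // => p /=.
  rewrite key ip0 (inj_eq (addrI _)) eqz_nat eq_sym; exact: (inj_eq inj).
rewrite big1 // => p; rewrite key => /eqP ip; case/negP: ni.
by rewrite inE; apply/sumset_APE; exists p.
Qed.

Lemma sum_color_ext (R : numDomainType) (N M : nat) (chi : coloring 'I_N) : (N < M)%N ->
  N%:R <= \sum_(x < M) `|(color_ext chi x)%:~R : R| ^+ 2.
Proof.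
move=> NM; rewrite -(big_mkord predT (fun x => `|(color_ext chi x)%:~R : R| ^+ 2)).
rewrite (@big_cat_nat _ _ _ 1) //=; last lia.
rewrite (@big_cat_nat _ _ _ N.+1 1 M) //=.
rewrite -[leLHS]add0r lerD ?sumr_ge0 // => [i _|]; first by rewrite exprn_ge0.
rewrite -[leLHS]addr0 lerD //; last by rewrite sumr_ge0 // => i _; rewrite exprn_ge0.
rewrite big_add1 big_mkord /= -[N in leLHS]card_ord -sumr_const.
apply: ler_sum => i _; rewrite /color_ext (big_pred1 i) => [|j]; last by rewrite eqSS.
by rewrite rmorphXn /= rmorphN1 normrX normrN1 !expr1n.
Qed.

(** * Lower bound for the discrepancy *)

Lemma exists_scale_parameter (N : nat) : (4 ^ 6 <= N)%N ->
  exists n, (2 ^ (2 * n + 12) <= N < 2 ^ (2 * n + 14))%N.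
Proof.
move=> N0; have Npos : (0 < N)%N by apply: leq_trans N0; rewrite expn_gt0.
have /andP[lo hi] := trunc_log_bounds (isT : (1 < 4)%N) Npos.
have m6 : (6 <= trunc_log 4 N)%N by rewrite trunc_log_max.
exists (trunc_log 4 N - 6)%N; move: lo hi m6; move: (trunc_log 4 N) => m.
rewrite -[4%N]/(2 ^ 2)%N -!expnM => lo hi m6.
rewrite (_ : 2 * (m - 6) + 12 = 2 * m)%N; last by clear -m6; lia.
by rewrite (_ : 2 * (m - 6) + 14 = 2 * m.+1)%N ?lo //; clear -m6; lia.
Qed.

Lemma disc_coloring_lower_bound (R : realType) (N : nat) (chi : coloring 'I_N) : (4 ^ 6 <= N)%N ->
  N%:R <= 2%:R ^+ 31 * (disc_coloring (@edges_2AP N) chi)%:R ^+ 2 :> R.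
Proof.
move=> /exists_scale_parameter[n /andP[lo hi]].
(* Here [2 * N < M <= 8 * N]: all lengths and differences are at most [M / 8 <= N], and [N] plus two
   spans of at most [M / 8] fits into [M]. *)
set D := disc_coloring _ _; pose M := (2 ^ (2 * n + 15))%N.
have ME : M = (2 ^ (2 * n + 12) * 8)%N by rewrite /M -[8%N]/(2 ^ 3)%N -expnD -addnA.
have NE : (2 ^ (2 * n + 14) = 2 ^ (2 * n + 12) * 4)%N by rewrite -[4%N]/(2 ^ 2)%N -expnD -addnA.
have NM : (N < M)%N by rewrite NE in hi; lia.
have [z zM z1] := exists_prim_root_near1 R (2 * n + 14).
rewrite -addnS -/M in zM z1.
pose f x : R[i] := (color_ext chi x)%:~R.
have fle : \sum_(x < M) `|f x| ^+ 2 <= 2%:R ^+ 31 * (D%:R ^+ 2).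
  apply: (pattern_lower_bound zM z1); first by rewrite exprn_ge0.
  move=> k d1 d2 a kn /andP[d10 d1l] /andP[d20 d2l] dir aM.
  have le_pow a' b' : (a' <= 2 ^ b')%N -> (b' <= 2 * n + 12)%N -> (a' <= N)%N.
    by move=> ab bn; apply: leq_trans ab (leq_trans _ lo); rewrite leq_exp2l.
  have [|||||E EE fE] := @color_sum_pattern N M chi
    (2 ^ (n + k + 3)) (2 ^ (n - k)) d1 d2 a _ _ _ _ dir _ aM.
  - by rewrite d10 (le_pow _ _ d1l) //; clear -kn; lia.
  - by rewrite d20 (le_pow _ _ d2l) //; clear -kn; lia.
  - by rewrite expn_gt0 (le_pow _ _ (leqnn _)) //; clear -kn; lia.
  - by rewrite expn_gt0 (le_pow _ _ (leqnn _)) //; clear -kn; lia.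
  - have h1 := leq_mul (leqnn (2 ^ (n + k + 3))) d1l.
    have h2 := leq_mul (leqnn (2 ^ (n - k))) d2l.
    have e1 : (2 ^ (n + k + 3) * 2 ^ (n - k + 6) <= 2 ^ (2 * n + 12))%N.
      by rewrite -expnD leq_exp2l //; clear -kn; lia.
    have e2 : (2 ^ (n - k) * 2 ^ (n + k + 9) <= 2 ^ (2 * n + 12))%N.
      by rewrite -expnD leq_exp2l //; clear -kn; lia.
    move: (leq_add (leq_trans h1 e1) (leq_trans h2 e2)) hi; rewrite ME NE.
    by move: (_ + _ * d2)%N (2 ^ (2 * n + 12))%N => u v; clear; lia.
  rewrite /f -rmorph_sum /= fE lerXn2r ?nnegrE //.
  by rewrite -intr_norm -abszE -pmulrn ler_nat disc_coloring_ge.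
have := le_trans (sum_color_ext (R[i]) chi NM) fle.
by rewrite -!(rmorph_nat (real_complex R)) -!rmorphXn -rmorphM lecR.
Qed.

Lemma disc_2AP_lower_bound (R : realType) (N : nat) : (4 ^ 6 <= N)%N ->
  N%:R <= 2%:R ^+ 31 * (disc_2AP N)%:R ^+ 2 :> R.
Proof. exact: disc_coloring_lower_bound. Qed.

(** * Random colourings *)

(** Invert [1 - x <= expR (- x)] and use [(1 - x) (1 + x + 2 x^2) = 1 + x^2 (1 - 2 x) >= 1]. *)
Lemma expR_le_quadratic (R : realType) (x : R) : x <= 1 / 2 -> expR x <= 1 + x + 2 * x ^+ 2.
Proof.
move=> x2; have h : 1 - x <= expR (- x) by exact: expR_ge1Dx.
have x1 : 0 < 1 - x by lra.
rewrite -[expR x]invrK -expRN; apply: (@le_trans _ _ (1 - x)^-1).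
  by rewrite lef_pV2 ?posrE ?expR_gt0.
by rewrite -[leLHS]mul1r ler_pdivrMr //; nra.
Qed.

Lemma expR_sym_le (R : realType) (l : R) : `|l| <= 1 / 2 ->
  expR l + expR (- l) <= 2 * expR (2 * l ^+ 2).
Proof.
rewrite ler_norml => /andP[l1 l2].
have h1 := expR_le_quadratic l2.
have h2 : expR (- l) <= 1 + - l + 2 * (- l) ^+ 2 by apply: expR_le_quadratic; lra.
have := expR_ge1Dx (2 * l ^+ 2); rewrite sqrrN in h2; lra.
Qed.

(** The exponential is a product over vertices, so the sum over colourings factorises; a vertex
    outside [E] contributes a factor 2. *)
Lemma sum_expR_color_sum (R : realType) (V : finType) (E : {set V}) (l : R) : `|l| <= 1 / 2 ->
  \sum_(chi : coloring V) expR (l * (color_sum chi E)%:~R)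
  <= (2 * expR (2 * l ^+ 2)) ^+ #|V|.
Proof.
move=> l2; pose g x (b : bool) : R := if x \in E then expR (l * (-1) ^+ b) else 1.
have -> : \sum_(chi : coloring V) expR (l * (color_sum chi E)%:~R)
    = \sum_(chi : {ffun V -> bool}) \prod_x g x (chi x).
  apply: eq_bigr => chi _; rewrite /color_sum rmorph_sum mulr_sumr expR_sum /=.
  rewrite big_mkcond; apply: eq_bigr => x _; rewrite /g; case: ifP => // _.
  by rewrite rmorphXn /= rmorphN1.
rewrite -(bigA_distr_bigA (fun x b => g x b)) /= -prodr_const.
apply: ler_prod => x _; rewrite big_bool /g; case: ifP => _.
  rewrite addr_ge0 ?expR_ge0 //= expr1 expr0 mulrN1 mulr1 addrC.
  exact: expR_sym_le.
have h : 1 <= expR (2 * l ^+ 2) by apply: le_trans (expR_ge1Dx _); have := sqr_ge0 l; lra.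
by rewrite /=; apply/andP; split; lra.
Qed.

(** The exponentials of both signs are summed over all [p]; some colouring does not exceed the
    average, and the sum dominates each of its terms. *)
Lemma exists_balanced_coloring (R : realType) (V P : finType) (E : P -> {set V}) (l : R) :
  0 <= l <= 1 / 2 -> exists chi : coloring V, forall p,
    expR (l * (`|color_sum chi (E p)|%N)%:R) <= 2 * #|P|%:R * expR (2 * l ^+ 2) ^+ #|V|.
Proof.
move=> /andP[l0 l2]; set B := 2 * _ * _.
have nl : `|l| <= 1 / 2 by rewrite ger0_norm.
pose S (chi : coloring V) : R := \sum_p
   (expR (l * (color_sum chi (E p))%:~R) + expR (- l * (color_sum chi (E p))%:~R)).
have Sle : \sum_chi S chi <= \sum_(chi : coloring V) B.
  rewrite exchange_big /= sumr_const card_ffun card_bool -[leRHS]mulr_natr natrX.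
  apply: (@le_trans _ _ (\sum_(p : P) 2 * (2 * expR (2 * l ^+ 2)) ^+ #|V|)).
    apply: ler_sum => p _; rewrite big_split mulr_natl mulr2n lerD ?sum_expR_color_sum //.
    by rewrite -[l ^+ 2]sqrrN sum_expR_color_sum // normrN.
  rewrite sumr_const -[leLHS]mulr_natr /B exprMn le_eqVlt; apply/orP; left; apply/eqP.
  by move: (expR _ ^+ _) (2 ^+ _) => A1 A2; ring.
have [chi chiB] : exists chi, S chi <= B.
  apply/not_existsP => H; move: Sle; apply/negP; rewrite -ltNge.
  apply: ltr_sum; first by apply/hasP; exists [ffun=> false]; rewrite ?mem_index_enum.
  by move=> chi _; rewrite ltNge; apply/negP/H.
exists chi => p; apply: le_trans chiB; rewrite /S (bigD1 p) //=.
apply: ler_wpDr; first by rewrite sumr_ge0 // => i _; rewrite addr_ge0 ?expR_ge0.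
rewrite -[(`|_|%N)%:R]/((`|color_sum chi (E p)|%N : int)%:~R) abszE.
case: (ger0P (color_sum chi (E p))) => _; first by rewrite ler_wpDr ?expR_ge0.
by rewrite rmorphN /= mulrN mulNr ler_wpDl ?expR_ge0.
Qed.

(** * Counting hyperedges and the upper bound *)

Definition edge_param (N : nat) : finType :=
  ('I_(2 * N ^ 2 + N).+1 * ('I_N * 'I_N) * ('I_N * 'I_N))%type.

(* Only the sum of the two starting points matters, and it lies in [-2 N^2, N]
   unless the trace is empty. *)
Definition edge_of_param (N : nat) (p : edge_param N) : {set 'I_N} :=
  trace N (sumset (AP (p.1.1%:Z - (2 * N ^ 2)%:Z) p.1.2.1.+1 p.2.1.+1) (AP 0 p.1.2.2.+1 p.2.2.+1)).

Lemma edge_of_paramP (N : nat) (E : {set 'I_N}) : E \in @edges_2AP N ->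
  E = finset.set0 \/ exists p, E = edge_of_param p.
Proof.
rewrite inE => -[a1 [a2 [d1 [d2 [L1 [L2 [hd1 hd2 hL1 hL2 ->]]]]]]].
set E0 := trace _ _; have [->|[x xE]] := finset.set_0Vmem E0; [by left|right].
move: xE; rewrite /E0 !inE => /sumset_APE[q xq].
(* The vertex [x] puts [a1 + a2] plus an offset from [0, 2 N^2] into [1, N], which bounds [b]. *)
pose b : int := a1 + a2 + (2 * N ^ 2)%N%:Z.
have [aN b0] : (`|b| < (2 * N ^ 2 + N).+1)%N /\ 0 <= b.
  have := ltn_ord q.1; have := ltn_ord q.2; have := ltn_ord x.
  have : (q.1 * d1 <= N * N)%N by apply: leq_mul; [have := ltn_ord q.1; lia|lia].
  have : (q.2 * d2 <= N * N)%N by apply: leq_mul; [have := ltn_ord q.2; lia|lia].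
  by rewrite /b -mulnn; lia.
have o d (h : (1 <= d <= N)%N) : (d.-1 < N)%N by lia.
exists (Ordinal aN, (Ordinal (o _ hd1), Ordinal (o _ hd2)), (Ordinal (o _ hL1), Ordinal (o _ hL2))).
rewrite /edge_of_param /= !prednK; try lia.
apply/setP => y; rewrite !inE; apply/idP/idP; rewrite !inE => /sumset_APE[p yp];
  apply/sumset_APE; exists p; rewrite yp; lia.
Qed.

(** The factor 2 accounts for the two signs in the union bound; the exponent becomes the term
    [9 * ln n]. *)
Lemma card_edge_param (N : nat) : (2 <= N)%N -> (2 * #|edge_param N| <= N ^ 9)%N.
Proof.
move=> N2; rewrite !card_prod !card_ord.
have N8 : (8 <= N * N * N)%N by rewrite (@leq_mul (2 * 2) 2) ?leq_mul.
have h : (2 * (2 * N ^ 2 + N).+1 <= N ^ 2 * (N * N * N))%N.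
  by apply: leq_trans (leq_mul (leqnn _) N8); rewrite -mulnn; nia.
have -> : (N ^ 9 = N ^ 2 * (N * N * N) * (N * N) * (N * N))%N by rewrite !expnS expn0 muln1 !mulnA.
by rewrite mulnA leq_mul // mulnA leq_mul.
Qed.

Lemma disc_2AP_upper_bound (R : realType) (N : nat) : (64 <= N)%N ->
  (disc_2AP N)%:R <= 11 * Num.sqrt (N%:R : R) * Num.sqrt (ln (N%:R : R)).
Proof.
move=> N64.
set n : R := N%:R; have n64 : 64 <= n by rewrite (ler_nat R 64).
have n0 : 0 < n by lra.
set r := Num.sqrt n; have r0 : 0 < r by rewrite sqrtr_gt0.
have rr : r ^+ 2 = n by rewrite sqr_sqrtr // ltW.
have r8 : 8 <= r by nra.
(* With [r >= 8] this gives [u <= r / 2], hence [l <= 1 / 2]; the threshold 64 comes from here. *)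
have lnr : ln n < 2 * r.
  by rewrite -rr lnXn // -[ltLHS]mulr_natl ltr_pM2l // ln_sublinear.
have ln0 : 0 < ln n by rewrite ln_gt0 //; lra.
set u := Num.sqrt (ln n); have u0 : 0 < u by rewrite sqrtr_gt0.
have uu : u ^+ 2 = ln n by rewrite sqr_sqrtr // ltW.
pose l := u / r; have lr : l * r = u by rewrite divfK // gt_eqF.
have l0 : 0 < l by rewrite divr_gt0.
have l2 : 0 <= l <= 1 / 2 by rewrite ltW //= ler_pdivrMr //; nra.
have [chi chiP] := exists_balanced_coloring (@edge_of_param N) l2.
apply: (@le_trans _ _ (disc_coloring (@edges_2AP N) chi)%:R); first by rewrite ler_nat disc_le.
have B0 : 0 <= 11 * r * u by nra.
rewrite /disc_coloring; elim/big_ind: _ => [//|x y hx hy|E EE].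
  by rewrite /maxn; case: ifP.
have [->|[p ->]] := edge_of_paramP EE; first by rewrite /color_sum big_set0.
have := chiP p; move: (`|_|%N) => s hs.
(* The right side equals [11 * u ^+ 2], and division by [l = u / r] gives [11 * r * u]. *)
have hln : l * s%:R <= 9 * ln n + 2 * l ^+ 2 * n.
  rewrite -[leLHS]expRK -[leRHS]expRK ler_ln ?posrE ?expR_gt0 //.
  apply: le_trans hs _; rewrite expRD card_ord expRM_natr.
  rewrite ler_wpM2r ?exprn_ge0 ?expR_ge0 //.
  rewrite expRM_natl lnK ?posrE // -natrX -natrM ler_nat card_edge_param //.
  exact: leq_trans N64.
rewrite -(ler_pM2l l0); apply: le_trans hln _; rewrite -uu -rr -lr le_eqVlt.
by apply/orP; left; apply/eqP; move: (l) (r) => l' r'; ring.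
Qed.

Theorem theorem1 (R : realType) :
  exists c C : R, exists N0 : nat,
    [/\ 0 < c, 0 < C
      & forall N : nat, (N0 <= N)%N ->
          c * Num.sqrt (N%:R : R) <= (disc_2AP N)%:R
          /\ (disc_2AP N)%:R <= C * Num.sqrt (N%:R : R) * Num.sqrt (ln (N%:R : R))].
Proof.
(* The constant [2 ^ 31] is rounded up to the square of [2 ^ 16]. *)
exists (2 ^+ 16)^-1, 11, (4 ^ 6)%N; split=> // [|N N0]; first by rewrite invr_gt0 exprn_gt0.
split; last by apply: disc_2AP_upper_bound; apply: leq_trans N0.
rewrite ler_pdivrMl ?exprn_gt0 // -[leRHS]ger0_norm ?mulr_ge0 ?exprn_ge0 //.
rewrite -sqrtr_sqr ler_sqrt ?sqr_ge0 // exprMn -exprM.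
apply: le_trans (disc_2AP_lower_bound R N0) _.
by rewrite ler_wpM2r ?exprn_ge0 // ler_eXn2l // ltr1n.
Qed.
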